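(* Let $\beta,\gamma$ be real numbers with $\gamma\neq 0$. Let $G$ be a digraph with no loops and no multiple arcs, with vertex set $V(G)=\{v_1,\ldots,v_n\}$ and arc set $E(G)$ of size $m$. Let $A$ be the adjacency matrix of $G$ and $D$ its in-degree diagonal matrix, and define the polynomials \[ g_1(G;x)=\det(xI_n-\beta D-\gamma A),\qquad g_2(G;x)={\rm per}(xI_n-\beta D-\gamma A). \] Then, as polynomials in $x$, \[ (m-n)g_1(G;x)+x\,g_1'(G;x)=\sum_{e\in E(G)}g_1(G-e;x), \] \[ (m-n)g_2(G;x)+x\,g_2'(G;x)=\sum_{e\in E(G)}g_2(G-e;x), \] where $g_i'$ denotes the derivative with respect to $x$.
   Context: For a digraph $G$ on vertices $v_1,\ldots,v_n$, the adjacency matrix is $A=(a_{ij})_{n\times n}$ with $a_{ij}=1$ if $(v_i,v_j)$ is an arc and $a_{ij}=0$ otherwise; the in-degree diagonal matrix is $D=\mathrm{diag}(d^+(v_1),\ldots,d^+(v_n))$, where $d^+(v_i)$ is the number of arcs with head $v_i$. For an arc $e$, $G-e$ is the digraph on the same vertex set $\{v_1,\ldots,v_n\}$ with arc set $E(G)\setminus\{e\}$, and $g_i(G-e;x)$ is defined using the adjacency and in-degree matrices of $G-e$. ${\rm per}$ denotes the permanent, ${\rm per}(Y)=\sum_{\alpha\in S_n}\prod_{k=1}^n y_{k\alpha(k)}$. *)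

(* Defs.v *)
From mathcomp Require Import all_boot all_order all_fingroup all_algebra.
From mathcomp Require Import reals.

Set Implicit Arguments.
Unset Strict Implicit.
Unset Printing Implicit Defensive.

Import GRing.Theory.
Local Open Scope ring_scope.

(* A digraph on the vertices 'I_n is given by its set of arcs (tail, head);
   since this is a set, there are no multiple arcs.  Deleting an arc e while
   keeping the vertex set is then G :\ e. *)
Definition digraph (n : nat) : Type := {set 'I_n * 'I_n}.

Definition loopless (n : nat) (G : digraph n) : Prop :=
  forall v : 'I_n, (v, v) \notin G.

Definition indeg (n : nat) (G : digraph n) (v : 'I_n) : nat :=
  #|[set e in G | e.2 == v]|.

Definition adj_mx (R : nzRingType) (n : nat) (G : digraph n) : 'M[R]_n :=
  \matrix_(i < n, j < n) (if (i, j) \in G then 1 else 0).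

Definition indeg_mx (R : nzRingType) (n : nat) (G : digraph n) : 'M[R]_n :=
  diag_mx (\row_(j < n) (indeg G j)%:R).

Definition permanent (R : comNzRingType) (n : nat) (Y : 'M[R]_n) : R :=
  \sum_(s : 'S_n) \prod_(k < n) Y k (s k).

Definition pencil (R : comNzRingType) (beta gamma : R) (n : nat)
    (G : digraph n) : 'M[{poly R}]_n :=
  'X%:M - map_mx polyC (beta *: indeg_mx R G) - map_mx polyC (gamma *: adj_mx R G).

Definition g1 (R : comNzRingType) (beta gamma : R) (n : nat)
    (G : digraph n) : {poly R} := \det (pencil beta gamma G).

Definition g2 (R : comNzRingType) (beta gamma : R) (n : nat)
    (G : digraph n) : {poly R} := permanent (pencil beta gamma G).

(* Main.v *)
Require Import Defs.
From mathcomp Require Import all_boot all_order all_fingroup all_algebra.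
From mathcomp Require Import reals.

Set Implicit Arguments.
Unset Strict Implicit.
Unset Printing Implicit Defensive.

Import GRing.Theory.
Local Open Scope ring_scope.

(** The determinant and the permanent are combinations, with scalar
    coefficients, of products picking one entry in each column of the pencil,
    and the identity already holds for every such product.  An arc [e]
    contributes a vector [- w_e] to the column of its head only, so deleting it
    adds [w_e] to this column; and the [w_e] over all the arcs with head [v] add
    up to [x] times the [v]-th unit vector minus the column [v] itself.  By
    multilinearity, summing over [e] produces [m] copies of the product, minus
    one copy for each column, plus [x] times its derivative. *)

Lemma deriv_prod (R : comNzRingType) (I : finType) (F : I -> {poly R}) :
  (\prod_i F i)^`() = \sum_i (F i)^`() * \prod_(j | j != i) F j.
Proof.
(* Induction needs a list in place of a finite type; since it has no duplicates, the condition
   [j != i] drops exactly one factor. *)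
suff derivP (r : seq I) : uniq r -> (\prod_(i <- r) F i)^`() =
    \sum_(i <- r) (F i)^`() * \prod_(j <- r | j != i) F j.
  exact: derivP (index_enum_uniq I).
elim: r => [|i r IHr] /= => [_|/andP[i_r r_uniq]].
  by rewrite !big_nil derivC.
rewrite !big_cons derivM IHr // eqxx mulr_sumr; congr (_ * _ + _).
  rewrite big_seq [RHS]big_seq_cond; apply: eq_bigl => j.
  by case j_r: (j \in r) => //=; apply/esym; apply: contraNneq i_r => <-.
apply: eq_big_seq => j j_r; rewrite big_cons mulrCA ifT //.
by apply: contraNneq i_r => ->.
Qed.

Lemma prod_add_at (R : comNzRingType) (I : finType) (F : I -> R) (v : I) (w : R) :
  \prod_j (F j + (if j == v then w else 0)) =
  \prod_j F j + w * \prod_(j | j != v) F j.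
Proof.
rewrite (bigD1 v) //= eqxx [\prod_j F j](bigD1 v) //= mulrDl.
have eqF : \prod_(j | j != v) (F j + (if j == v then w else 0)) =
    \prod_(j | j != v) F j.
  by apply: eq_bigr => j /negbTE->; rewrite addr0.
by rewrite eqF.
Qed.

Section ArcDeletion.

Variables (R : comNzRingType) (beta gamma : R) (n : nat).
Implicit Types (G : digraph n) (e : 'I_n * 'I_n) (i j v : 'I_n).

Definition arc_weight e i : R :=
  beta * (i == e.2)%:R + gamma * (i == e.1)%:R.

(** An arc adds [beta] in the row of its head, through the in-degree, and [gamma] in the row of its
    tail, through the adjacency matrix; both land in the column of its head. *)
Lemma pencilE G i j : pencil beta gamma G i j =
  'X *+ (i == j) - (\sum_(e in G | e.2 == j) arc_weight e i)%:P.
Proof.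
rewrite !mxE big_split /= -!mulr_sumr -addrA -opprD -polyCD.
congr (_ - (_ + _ * _)%:P).
  congr (_ * _); rewrite [RHS](eq_bigr (fun=> (i == j)%:R)); last first.
    by move=> e /andP[_ /eqP->].
  rewrite /indeg -sum1_card natr_sum -sumrMnl.
  case: eqVneq => [->|_]; last by rewrite !big1.
  by apply: eq_bigl => e; rewrite inE.
(* In the [gamma] part, tail [i] and head [j] leave [(i, j)] as the only possible arc. *)
case: ifP => ijG.
  rewrite (bigD1 (i, j)) /= ?ijG ?eqxx // big1 ?addr0 // => -[k l] /=.
  case/andP=> /andP[_ /eqP->]; rewrite xpair_eqE eqxx andbT eq_sym.
  by move/negbTE->.
rewrite big1 // => -[k l] /= /andP[klG /eqP lj].
by case: eqP => // ik; rewrite ik -lj klG in ijG.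
Qed.

Lemma pencil_del G e i j : e \in G -> pencil beta gamma (G :\ e) i j =
  pencil beta gamma G i j + (if j == e.2 then (arc_weight e i)%:P else 0).
Proof.
move=> eG; rewrite !pencilE -addrA; congr (_ + _).
have delE : (fun a => (a \in G :\ e) && (a.2 == j)) =1
    (fun a => ((a \in G) && (a.2 == j)) && (a != e)).
  by move=> a; rewrite !inE -andbA andbC.
rewrite (eq_bigl _ _ delE) eq_sym; case: eqP => ej.
  by rewrite [in RHS](bigD1 e) /= ?eG ?ej ?eqxx // polyCD opprD addrAC addNr add0r.
rewrite addr0; congr (- _%:P); apply: eq_bigl => a.
by case: (a =P e) => [->|_]; rewrite ?andbT // (introF eqP ej) andbF.
Qed.

Lemma deriv_pencil G i j : (pencil beta gamma G i j)^`() = (i == j)%:R.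
Proof. by rewrite pencilE derivB derivC subr0 derivMn derivX. Qed.

Definition column_prod (f : 'I_n -> 'I_n) G : {poly R} :=
  \prod_j pencil beta gamma G (f j) j.

Lemma sum_column_prod_del f G :
  \sum_(e in G) column_prod f (G :\ e) =
  (#|G|%:R - n%:R) * column_prod f G + 'X * (column_prod f G)^`().
Proof.
pose Q v := \prod_(j | j != v) pencil beta gamma G (f j) j.
have delE e : e \in G -> column_prod f (G :\ e) =
    column_prod f G + (arc_weight e (f e.2))%:P * Q e.2.
  move=> eG; rewrite -prod_add_at; apply: eq_bigr => j _.
  by rewrite pencil_del //; case: eqP => // ->.
rewrite (eq_bigr _ delE) big_split /= sumr_const.
rewrite (partition_big snd xpredT) //=.
(* The factor [i == j] of ['X] in [pencilE] is the derivative of the entry, so the weights into [v]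
   sum to ['X] times this derivative minus the entry. *)
have headE v : \sum_(e in G | e.2 == v) (arc_weight e (f e.2))%:P * Q e.2 =
    'X * ((pencil beta gamma G (f v) v)^`() * Q v) - column_prod f G.
  rewrite /column_prod (bigD1 v) //= -/(Q v) mulrA -mulrBl deriv_pencil.
  rewrite pencilE mulr_natr opprB addrCA subrr addr0 rmorph_sum mulr_suml.
  by apply: eq_bigr => e /andP[_ /eqP->].
(* Over the [n] heads, the terms in ['X] assemble into the derivative of the product by the Leibniz
   rule. *)
rewrite (eq_bigr _ (fun v _ => headE v)) sumrB sumr_const card_ord -mulr_sumr.
rewrite -deriv_prod mulrBl !mulr_natl -/(column_prod f G).
by rewrite addrCA addrC.
Qed.

(** Both sides are linear in [g], as the coefficients are constant in ['X] and independent of the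
    digraph. *)
Lemma sum_column_comb_del (c : 'S_n -> R) (g : digraph n -> {poly R}) G :
  (forall H, g H = \sum_s (c s)%:P * column_prod s H) ->
  (#|G|%:R - n%:R) * g G + 'X * (g G)^`() = \sum_(e in G) g (G :\ e).
Proof.
move=> gE; rewrite (eq_bigr _ (fun e _ => gE (G :\ e))) exchange_big /= gE.
rewrite raddf_sum !mulr_sumr -big_split; apply: eq_bigr => s _ /=.
rewrite -mulr_sumr sum_column_prod_del derivM derivC mul0r add0r.
by rewrite mulrDr !(mulrCA (c s)%:P).
Qed.

Lemma g1_column_prod G :
  g1 beta gamma G = \sum_s ((-1) ^+ odd_perm s)%:P * column_prod s G.
Proof.
(* Transposing turns one entry per row into one per column. *)
rewrite /g1 -det_tr; apply: eq_bigr => s _; rewrite polyC_exp polyCN.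
by congr (_ * _); apply: eq_bigr => j _; rewrite mxE.
Qed.

Lemma g2_column_prod G :
  g2 beta gamma G = \sum_s (1 : R)%:P * column_prod (s : 'S_n) G.
Proof.
(* Inverting the permutation, then indexing the factors by columns, has the same effect for the
   permanent. *)
rewrite /g2 /permanent (reindex_inj invg_inj) /=; apply: eq_bigr => s _.
rewrite mul1r (reindex_inj (@perm_inj _ s)) /=.
by apply: eq_bigr => j _; rewrite permK.
Qed.

End ArcDeletion.

Theorem theorem3p1 (R : realType) (beta gamma : R) (n m : nat) (G : digraph n)
    (gamma_neq0 : gamma != 0) (G_loopless : loopless G) (card_arcs : #|G| = m) :
  (m%:R - n%:R) * g1 beta gamma G + 'X * (g1 beta gamma G)^`()
    = \sum_(e in G) g1 beta gamma (G :\ e)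
  /\
  (m%:R - n%:R) * g2 beta gamma G + 'X * (g2 beta gamma G)^`()
    = \sum_(e in G) g2 beta gamma (G :\ e).
Proof.
rewrite -card_arcs; split; apply: sum_column_comb_del.
  exact: g1_column_prod.
exact: g2_column_prod.
Qed.
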